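(* Let $R$ be a ring and $N$ a nilpotent ideal of nilpotency index $k\geq 2$ in $R$. Let $s>1$ be the characteristic of the quotient ring $R/N$, and let $f\in R$. Then $f+N$ is an invertible element of $R/N$ if and only if $f+N\subset R^{\ast}$. Furthermore, in this case, for each $x\in f+N$, \[x^{-1}=g(xg)^{s^{k-1}-1},\] where $g\in R$ is any element such that $\bar f\,\bar g=\bar 1$ in $R/N$. Moreover, $|R^{\ast}|=|(R/N)^{\ast}|\,|N|$.
   Context: Rings are associative with identity $1$, not necessarily commutative; ideals are two-sided. $R^{\ast}$ denotes the group of invertible elements of $R$, and $\bar f=f+N$ denotes the class of $f\in R$ in $R/N$. The nilpotency index of a nilpotent ideal $N$ is the least $k$ with $N^k=\{0\}$. *)

(* Defs.v *)
From HB Require Import structures.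
From mathcomp Require Import all_boot all_order all_algebra.
From mathcomp Require Import all_classical.

Set Implicit Arguments.
Unset Strict Implicit.
Unset Printing Implicit Defensive.

Import GRing.Theory.
Import Quotient.
Local Open Scope ring_scope.
Local Open Scope quotient_scope.
Local Open Scope classical_set_scope.

(* mathcomp's [idealr] is one-sided and proper, and its ring structure on
   [{quot I}] is restricted to commutative rings.  Neither restriction is
   wanted here, hence the following structure and quotient.  Membership in an
   ideal is boolean, which is no loss in the presence of [boolp]. *)

HB.mixin Record isTwoSided (R : pzRingType) (I : R -> bool) := {
  twosided_mull : forall a u : R, I u -> I (a * u);
  twosided_mulr : forall a u : R, I u -> I (u * a)
}.

#[short(type="twosided_ideal")]
HB.structure Definition TwoSidedIdeal (R : pzRingType) :=
  {I of GRing.ZmodClosed R I & isTwoSided R I}.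

(* An alias of mathcomp's quotient group [{quot I}], so that the instances
   below do not clash with those of the commutative case. *)
Definition ring_quot (R : pzRingType) (I : twosided_ideal R) : Type := {quot I}.

Section RingQuot.
Variables (R : pzRingType) (I : twosided_ideal R).
Local Notation Q := (ring_quot I).

HB.instance Definition _ := ZmodQuotient.on Q.

Definition ring_quot_one : Q := lift_cst Q 1.
Definition ring_quot_mul : Q -> Q -> Q := lift_op2 Q *%R.

Lemma ring_quot_eqP (x y : R) : \pi_Q x = \pi_Q y <-> x - y \in I.
Proof.
rewrite (idealrBE (I : zmodClosed R)); split; first by move=> xy; apply/eqP.
by move/eqP.
Qed.

Lemma ring_quot_pi_one : \pi_Q 1 = ring_quot_one.
Proof. by rewrite /ring_quot_one; unlock. Qed.

Lemma ring_quot_pi_mul : {morph \pi_Q : x y / x * y >-> ring_quot_mul x y}.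
Proof.
move=> x y; unlock ring_quot_mul; apply/ring_quot_eqP.
set x' := repr _; set y' := repr _.
have xI : x - x' \in I by apply/ring_quot_eqP; rewrite reprK.
have yI : y - y' \in I by apply/ring_quot_eqP; rewrite reprK.
rewrite -[x * y](addrNK (x * y')) -mulrBr -addrA -mulrBl.
by apply: rpredD; [exact: twosided_mull | exact: twosided_mulr].
Qed.

Fact ring_quot_mulA : associative ring_quot_mul.
Proof.
move=> x y z; elim/quotW: x => x; elim/quotW: y => y; elim/quotW: z => z.
by rewrite -!ring_quot_pi_mul mulrA.
Qed.

Fact ring_quot_mul1 : left_id ring_quot_one ring_quot_mul.
Proof.
by elim/quotW=> x; rewrite -ring_quot_pi_one -ring_quot_pi_mul mul1r.
Qed.

Fact ring_quot_mulr1 : right_id ring_quot_one ring_quot_mul.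
Proof.
by elim/quotW=> x; rewrite -ring_quot_pi_one -ring_quot_pi_mul mulr1.
Qed.

Fact ring_quot_mulDl : left_distributive ring_quot_mul +%R.
Proof.
move=> x y z; elim/quotW: x => x; elim/quotW: y => y; elim/quotW: z => z.
by rewrite -pi_addr -!ring_quot_pi_mul -pi_addr mulrDl.
Qed.

Fact ring_quot_mulDr : right_distributive ring_quot_mul +%R.
Proof.
move=> x y z; elim/quotW: x => x; elim/quotW: y => y; elim/quotW: z => z.
by rewrite -pi_addr -!ring_quot_pi_mul -pi_addr mulrDr.
Qed.

HB.instance Definition _ := GRing.Zmodule_isPzRing.Build Q
  ring_quot_mulA ring_quot_mul1 ring_quot_mulr1 ring_quot_mulDl ring_quot_mulDr.

End RingQuot.

(* The class of [x] in [R / I]. *)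
Definition ring_class (R : pzRingType) (I : twosided_ideal R) (x : R) :
  ring_quot I := \pi_(ring_quot I) x.

Section RingClass.
Variables (R : pzRingType) (I : twosided_ideal R).

Fact ring_class_is_zmod_morphism : zmod_morphism (@ring_class R I).
Proof. by move=> x y; rewrite /ring_class pi_addr pi_oppr. Qed.

Fact ring_class_is_monoid_morphism : monoid_morphism (@ring_class R I).
Proof.
by split=> [|x y]; [exact: ring_quot_pi_one | exact: ring_quot_pi_mul].
Qed.

HB.instance Definition _ := GRing.isZmodMorphism.Build R (ring_quot I)
  (@ring_class R I) ring_class_is_zmod_morphism.
HB.instance Definition _ := GRing.isMonoidMorphism.Build R (ring_quot I)
  (@ring_class R I) ring_class_is_monoid_morphism.

Lemma ring_class_eqP (x y : R) :
  ring_class I x = ring_class I y <-> x - y \in I.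
Proof. exact: ring_quot_eqP. Qed.

End RingClass.

(* [x + I] as a subset of [R]. *)
Definition ideal_coset (R : pzRingType) (I : twosided_ideal R) (x : R) : set R :=
  [set x + n | n in [set` I]].

(* Units are taken in arbitrary rings, possibly trivial and without a chosen
   inversion, as [R / I] carries no canonical [unitRingType] structure. *)
Definition is_inverse (S : pzRingType) (x y : S) : Prop :=
  x * y = 1 /\ y * x = 1.

Definition units (S : pzRingType) : set S :=
  [set x | exists y, is_inverse x y].
Arguments units S : clear implicits.

(* The additive subgroup generated by the products [a * b]; it is closed under
   negation when [A] is. *)
Definition set_mul (R : pzRingType) (A B : set R) : set R :=
  [set x | exists2 s : seq (R * R),
     [set` s] `<=` A `*` B & x = \sum_(p <- s) p.1 * p.2].

Fixpoint ideal_pow (R : pzRingType) (I : twosided_ideal R) (k : nat) : set R :=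
  if k is k'.+1 then set_mul [set` I] (ideal_pow I k') else setT.

Definition nilpotency_index (R : pzRingType) (I : twosided_ideal R) (k : nat) :
  Prop :=
  ideal_pow I k = [set 0] /\ (forall j, ideal_pow I j = [set 0] -> (k <= j)%N).

(* mathcomp's [pchar] only records prime characteristics. *)
Definition is_characteristic (S : pzRingType) (s : nat) : Prop :=
  if s is 0 then forall m, (0 < m)%N -> m%:R <> 0 :> S
  else s%:R = 0 :> S /\ (forall m, (0 < m)%N -> m%:R = 0 :> S -> (s <= m)%N).
Arguments is_characteristic S s : clear implicits.

(* Main.v *)
Require Import Defs.
From HB Require Import structures.
From mathcomp Require Import all_boot all_order all_algebra.
From mathcomp Require Import all_classical.

Import GRing.Theory.
Local Open Scope ring_scope.
Local Open Scope classical_set_scope.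
Local Open Scope card_scope.

(** Everything rests on one exponent that kills the whole group 1 + N.  If [u]
    is congruent to 1 modulo N and [u - 1] lies in N^i, then
    [u ^+ s - 1 = (1 + u + ... + u ^+ (s - 1)) * (u - 1)], and the first factor
    is congruent to [s], hence to 0, modulo N; so [u ^+ s - 1] lies in N^(i+1).
    Starting from N^1 and taking [k - 1] successive [s]-th powers reaches
    N^k = 0, that is, [u ^+ (s ^ (k - 1)) = 1] ([unipotent_exp_eq1]).

    Let now [x] and [g] have mutually inverse classes.  Both [x * g] and
    [g * x] lie in 1 + N, so both have trivial [s ^ (k - 1)]-th power, and
    regrouping [(x * g) ^+ e = x * (g * (x * g) ^+ (e - 1))] and
    [(g * x) ^+ e = (g * (x * g) ^+ (e - 1)) * x] displays the two-sided inverse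
    of [x] ([is_inverse_class]).  Thus the units of R are exactly the elements
    whose class is a unit ([units_class]): they form a union of cosets of N, one
    for each unit of R / N, whence the cardinality ([card_preimage_class]). *)

Section PzRing.
Variable S : pzRingType.
Implicit Types x y g : S.

Lemma is_inverse_exp x g e :
  (x * g) ^+ e.+1 = 1 -> (g * x) ^+ e.+1 = 1 -> is_inverse x (g * (x * g) ^+ e).
Proof.
move=> xg1 gx1; split; first by rewrite mulrA -exprS.
rewrite -{}gx1; elim: e {xg1} => [|e IHe]; first by rewrite expr0 mulr1 expr1.
by rewrite exprS [RHS]exprS -IHe !mulrA.
Qed.

Lemma units_right_inverse x y : units S x -> x * y = 1 -> is_inverse x y.
Proof.
move=> [z [_ zx1]] xy1; split=> //.
by rewrite -[y]mul1r -zx1 -(mulrA z) xy1 mulr1.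
Qed.

(** The product is written with [x - 1] on the right because the powers of an
    ideal are built by multiplying on the left. *)
Lemma subrX1_sumMl x n : x ^+ n - 1 = (\sum_(i < n) x ^+ i) * (x - 1).
Proof.
rewrite subrX1; apply/esym/commrB; last exact: commr1.
by apply/commr_sym/commr_sum => i _; apply/commrX.
Qed.

End PzRing.

Lemma characteristic_natr0 (S : pzRingType) s : is_characteristic S s ->
  s%:R = 0 :> S.
Proof. by case: s => [|s] // []. Qed.

Lemma set_mulM (R : pzRingType) (A B : set R) a b :
  A a -> B b -> set_mul A B (a * b).
Proof.
move=> Aa Bb; exists [:: (a, b)]; last by rewrite big_seq1.
by move=> p; rewrite /= inE => /eqP ->.
Qed.

Section Coset.
Variables (R : pzRingType) (N : twosided_ideal R).
Implicit Types x g u : R.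

Lemma ring_class_eq0P x : ring_class N x = 0 <-> x \in N.
Proof. by rewrite -(rmorph0 (ring_class N)) ring_class_eqP subr0. Qed.

Lemma ideal_cosetP f x : ideal_coset N f x <-> ring_class N x = ring_class N f.
Proof.
rewrite ring_class_eqP; split=> [[n Nn <-]|xfN]; first by rewrite addrC addKr.
by exists (x - f) => //; rewrite addrC subrK.
Qed.

Lemma ring_class_units x : units R x -> units (ring_quot N) (ring_class N x).
Proof.
move=> [y [xy1 yx1]]; exists (ring_class N y).
by split; rewrite -rmorphM ?xy1 ?yx1 rmorph1.
Qed.

Lemma ring_class_surj (q : ring_quot N) : exists x, ring_class N x = q.
Proof. by exists (generic_quotient.repr q); exact: generic_quotient.reprK. Qed.

(** A choice of coset representatives [r] identifies a union of cosets with a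
    product through [(q, n) |-> r q + n]. *)
Lemma card_preimage_class (A : set (ring_quot N)) :
  ring_class N @^-1` A #= A `*` [set` N].
Proof.
have [r rK] := choice ring_class_surj.
pose add_repr (p : ring_quot N * R) := r p.1 + p.2.
have class_add q n : n \in N -> ring_class N (r q + n) = q.
  by move=> /ring_class_eq0P nN; rewrite rmorphD /= nN addr0 rK.
have -> : ring_class N @^-1` A = [set add_repr p | p in A `*` [set` N]].
  apply/seteqP; split=> [x Ax|_ [[q n] [Aq Nn] <-]]; last first.
    by rewrite /preimage /add_repr /= class_add.
  exists (ring_class N x, x - r (ring_class N x)); last first.
    by rewrite /add_repr /= addrC subrK.
  by split=> //=; apply/ring_class_eqP; rewrite rK.
apply: inj_card_eq => -[q n] [q' n']; rewrite !inE => -[_ /= Nn] [_ /= Nn'].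
rewrite /add_repr /= => eq_sum.
have qq' : q = q' by rewrite -(class_add q n) // eq_sum class_add.
by move: eq_sum; rewrite qq' => /addrI ->.
Qed.

Section CharacteristicPower.
Variable s : nat.
Hypothesis s0 : s%:R = 0 :> ring_quot N.

Lemma unipotent_exp u i :
  ring_class N u = 1 -> ideal_pow N i.+1 (u ^+ (s ^ i) - 1).
Proof.
move=> u1; elim: i => [|i IHi].
  (* The first power of N is encoded as N * R, hence the factor 1. *)
  rewrite expn0 expr1 -[u - 1]mulr1; apply: set_mulM => //=.
  by apply/ring_class_eqP; rewrite u1 rmorph1.
rewrite expnSr exprM subrX1_sumMl; apply: set_mulM => //=.
apply/ring_class_eq0P; rewrite rmorph_sum -[RHS]s0.
under eq_bigr do rewrite !rmorphXn /= u1 !expr1n.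
by rewrite sumr_const card_ord.
Qed.

Variable k : nat.
Hypotheses (Nk0 : ideal_pow N k = [set 0]) (k_gt0 : (0 < k)%N).

Lemma unipotent_exp_eq1 u : ring_class N u = 1 -> u ^+ (s ^ (k - 1)) = 1.
Proof.
move=> /(@unipotent_exp _ (k - 1)).
by rewrite subn1 prednK // Nk0 => /eqP; rewrite subr_eq0 => /eqP.
Qed.

Hypothesis s_gt0 : (0 < s)%N.

(** Asking for inverse classes on both sides puts [g * x], and not only [x * g],
    in 1 + N; this yields the left inverse without knowing beforehand that [x]
    is a unit. *)
Lemma is_inverse_class x g : is_inverse (ring_class N x) (ring_class N g) ->
  is_inverse x (g * (x * g) ^+ (s ^ (k - 1) - 1)).
Proof.
have expK : (s ^ (k - 1) - 1).+1 = (s ^ (k - 1))%N.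
  by rewrite subn1 prednK // expn_gt0 s_gt0.
by move=> [xg1 gx1]; apply: is_inverse_exp;
  rewrite expK unipotent_exp_eq1 // rmorphM.
Qed.

Lemma units_class : units R = ring_class N @^-1` units (ring_quot N).
Proof.
apply/seteqP; split=> x; first exact: ring_class_units.
move=> [q]; have [g <-] := ring_class_surj q => xg_inv.
by eexists; exact: is_inverse_class xg_inv.
Qed.

End CharacteristicPower.
End Coset.

Theorem proposition4p1 (R : pzRingType) (N : twosided_ideal R) (k s : nat)
    (f : R) :
  nilpotency_index N k -> (2 <= k)%N ->
  is_characteristic (ring_quot N) s -> (1 < s)%N ->
  [/\ units (ring_quot N) (ring_class N f) <-> ideal_coset N f `<=` units R,
      units (ring_quot N) (ring_class N f) ->
        forall x g : R, ideal_coset N f x ->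
          ring_class N f * ring_class N g = 1 ->
          is_inverse x (g * (x * g) ^+ (s ^ (k - 1) - 1))
    & units R #= units (ring_quot N) `*` [set` N]].
Proof.
move=> [Nk0 _] /ltnW k_gt0 /characteristic_natr0 s0 /ltnW s_gt0.
have unitsE := units_class _ _ _ s0 _ Nk0 k_gt0 s_gt0; split.
- rewrite unitsE; split=> [uf x /ideal_cosetP xf|]; last first.
    by apply; apply/ideal_cosetP.
  by rewrite /preimage /= xf.
- move=> uf x g /ideal_cosetP xf fg1; apply: (is_inverse_class _ _ _ s0 _ Nk0) => //.
  by rewrite xf; exact: units_right_inverse.
- by rewrite unitsE; exact: card_preimage_class.
Qed.
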